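(* Let $p\ge 2$ be an integer and $q=1/p$. Then the numbers $1$, $\zeta_q(1)$ and $\zeta_q(2)$ are linearly independent over $\mathbb{Q}$.
   Context: $\zeta_q(1)=\sum_{n=1}^\infty \frac{q^n}{1-q^n}=\sum_{n=1}^\infty\frac{1}{p^n-1}$ and $\zeta_q(2)=\sum_{n=1}^\infty \frac{nq^n}{1-q^n}=\sum_{n=1}^\infty\frac{n}{p^n-1}$. *)

(* Defs.v *)
From HB Require Import structures.
From mathcomp Require Import all_boot all_order all_algebra.
From mathcomp Require Import all_classical all_reals.
From mathcomp Require Import topology normedtype sequences.

Set Implicit Arguments.
Unset Strict Implicit.
Unset Printing Implicit Defensive.

Import Order.TTheory GRing.Theory Num.Theory.
Import numFieldNormedType.Exports.
Local Open Scope ring_scope.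

(* The limits of partial sums below exist for `|q| < 1, where the series
   converge absolutely; otherwise the values may be meaningless. *)

Definition zetaq1 (R : realType) (q : R) : R :=
  \big[+%R/0]_(1 <= n <oo) (q ^+ n / (1 - q ^+ n)).

Definition zetaq2 (R : realType) (q : R) : R :=
  \big[+%R/0]_(1 <= n <oo) (n%:R * q ^+ n / (1 - q ^+ n)).

(* The library's [free] needs a finite-dimensional space over the scalars,
   which a realType is not over rat. *)
Definition lin_indep_rat (R : realType) (k : nat) (v : k.-tuple R) : Prop :=
  forall c : 'I_k -> rat,
    \sum_(i < k) ratr (c i) * tnth v i = 0 -> forall i, c i = 0.

(* Main.v *)
Require Import Defs.
From mathcomp Require Import all_boot all_order all_algebra.
From mathcomp Require Import all_classical all_reals.
From mathcomp Require Import topology normedtype sequences.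
From mathcomp Require Import zify ring lra.
Import Order.TTheory GRing.Theory Num.Theory.
Import numFieldNormedType.Exports.
Local Open Scope ring_scope.

Set Implicit Arguments.
Unset Strict Implicit.
Unset Printing Implicit Defensive.

(* Put r(x) = x^n prod_{1<=j<=n} (1 - p^j x)^2 / prod_{0<=i<=n} (p^i - x).  Its
   partial fraction expansion has an integral polynomial part of degree < 2n and
   residues that are integral multiples of prod_{k<=n} (p^k - 1).  Summing r(q^t)
   and (x r')(q^t) over t >= 1 therefore gives b zeta_q(1) - a_1 and
   b zeta_q(2) - a_2 with the same b (the second one because
   zeta_q(2) = sum q^n / (1-q^n)^2), and b, a_1, a_2 become integers after
   multiplication by D = prod_{n<=k<2n} (p^k - 1).  The double zeros at q, ..., q^n
   make both sums start at t = n+1, and then the first one, l_1, satisfies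
   0 < D l_1 = O(2^n q^(2n)).  The quotient x r'(x) / r(x) lies between n - 4
   and 2n + 1 at these points, so that (n-4) l_1 <= l_2 <= (2n+1) l_1.  A relation
   e_0 + e_1 zeta_q(1) + e_2 zeta_q(2) = 0 would make D (e_1 l_1 + e_2 l_2) an
   integer which tends to 0 but is nonzero for large n. *)

(** * Divisibility of products of the numbers p^k - 1 *)

Definition qfact (p n : nat) : nat := (\prod_(1 <= k < n.+1) (p ^ k).-1)%N.

Lemma qfactS p n : qfact p n.+1 = (qfact p n * (p ^ n.+1).-1)%N.
Proof. by rewrite /qfact big_nat_recr. Qed.

Lemma predX_gt0 p k : (1 < p)%N -> (0 < k)%N -> (0 < (p ^ k).-1)%N.
Proof. by move=> p1 k0; rewrite -subn1 subn_gt0 -{1}(exp1n k) ltn_exp2r. Qed.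

Lemma qfact_gt0 p n : (1 < p)%N -> (0 < qfact p n)%N.
Proof.
move=> p1; rewrite /qfact big_nat; apply: prodn_cond_gt0 => k /andP[k0 _].
exact: predX_gt0.
Qed.

(** The quotient is a Gaussian binomial coefficient at p, since [qfact p n] is (p - 1)^n times the
    Gaussian factorial. Integrality follows by induction on a + b from the Pascal rule based on
    p^(a+b) - 1 = p^b (p^a - 1) + (p^b - 1). *)
Lemma dvdn_qfactD p a b : (0 < p)%N -> (qfact p a * qfact p b %| qfact p (a + b))%N.
Proof.
move=> p0; have [m le_m] := ubnP (a + b)%N.
elim: m a b le_m => [//|m IH] [|a] [|b] le_m.
- by rewrite /qfact big_geq.
- by rewrite /qfact big_geq // mul1n.
- by rewrite {2}/qfact big_geq // muln1 addn0.
have pE : ((p ^ (a.+1 + b.+1)).-1 = p ^ b.+1 * (p ^ a.+1).-1 + (p ^ b.+1).-1)%N.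
  have : (0 < p ^ a.+1)%N by rewrite expn_gt0 p0.
  have : (0 < p ^ b.+1)%N by rewrite expn_gt0 p0.
  by rewrite expnD; nia.
have -> : qfact p (a.+1 + b.+1) = (qfact p (a.+1 + b) * (p ^ (a.+1 + b.+1)).-1)%N.
  by rewrite addnS qfactS.
rewrite pE mulnDr dvdn_add //.
  rewrite mulnCA dvdn_mull // qfactS mulnAC dvdn_mul // addSnnS IH //; lia.
by rewrite (qfactS p b) mulnA dvdn_mul // IH //; lia.
Qed.

Lemma prod_qfact p n i :
  ((\prod_(1 <= j < n.+1) (p ^ (i + j)).-1) * qfact p i = qfact p (n + i))%N.
Proof.
elim: n => [|n IH]; first by rewrite big_geq ?mul1n.
by rewrite big_nat_recr //= addSn qfactS -IH addnS addnC mulnAC.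
Qed.

Lemma dvdn_predX p k m : (k %| m)%N -> ((p ^ k).-1 %| (p ^ m).-1)%N.
Proof. by move=> /dvdnP[d ->]; rewrite mulnC expnM dvdn_pred_predX. Qed.

Lemma dvdn_prod_nat (F : nat -> nat) a b k :
  (a <= k < b)%N -> (F k %| \prod_(a <= i < b) F i)%N.
Proof.
move=> kab; rewrite (bigD1_seq k) ?mem_index_iota ?iota_uniq ?dvdn_mulr //.
Qed.

Lemma dvdn_window p n k : (0 < k < n.*2)%N ->
  ((p ^ k).-1 %| \prod_(n <= i < n.*2) (p ^ i).-1)%N.
Proof.
move=> /andP[k0 kn].
have [m mw km] : exists2 m, (n <= m < n.*2)%N & (k %| m)%N.
  have [nk|nk] := leqP n k; first by exists k; rewrite ?nk.
  (* For k < n this is the least multiple of k that is at least n; it is at most n + k - 1 < 2n. *)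
  exists ((n + k.-1) %/ k * k)%N; last exact: dvdn_mull.
  have := divn_eq (n + k.-1) k; have := ltn_pmod (n + k.-1) k0; lia.
exact: dvdn_trans (dvdn_predX p km) (@dvdn_prod_nat (fun i => (p ^ i).-1) _ _ _ mw).
Qed.

(** Together with [prod_subX_gt] this evaluates, up to sign, the product of p^i - p^l over l != i,
    the denominator of the residue at p^i: the smaller power is extracted from each factor. *)
Lemma prod_subX_lt p i : (0 < p)%N ->
  (\prod_(0 <= l < i) (p ^ i - p ^ l) = \prod_(0 <= l < i) p ^ l * qfact p i)%N.
Proof.
move=> p0; rewrite /qfact big_add1 /= [X in (_ * X)%N]big_nat_rev /= -big_split /=.
apply: eq_big_nat => l /andP[_ li].
by rewrite add0n -subSn // subSS -subn1 mulnBr muln1 -expnD subnKC // ltnW.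
Qed.

Lemma prod_subX_gt p i n : (i <= n)%N -> (0 < p)%N ->
  (\prod_(i.+1 <= l < n.+1) (p ^ l - p ^ i) = p ^ (i * (n - i)) * qfact p (n - i))%N.
Proof.
move=> le_in p0; rewrite -[X in \prod_(X <= _ < _) _]add1n big_addn subSn // /qfact.
have -> : (p ^ (i * (n - i)) = \prod_(1 <= k < (n - i).+1) p ^ i)%N.
  by rewrite prod_nat_const_nat expnM subn1.
rewrite -big_split /=.
by apply: eq_big_nat => l _; rewrite addnC expnD -subn1 mulnBr muln1.
Qed.

(** Up to powers of p, the two products on the left amount to [qfact p i * qfact p (n - i)], a
    divisor of [qfact p n]. On the right, the squared product supplies two factors [qfact p n]: one
    absorbs this divisor, the other is the extra factor claimed. *)
Lemma dvdn_residue p n i : (i <= n)%N -> (1 < p)%N ->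
  (p ^ i * (\prod_(0 <= l < i) (p ^ i - p ^ l) * \prod_(i.+1 <= l < n.+1) (p ^ l - p ^ i))
     * qfact p n %| p ^ (i * n) * (\prod_(1 <= j < n.+1) (p ^ (i + j)).-1) ^ 2)%N.
Proof.
move=> le_in p1; have p0 := ltnW p1.
have /dvdnP[c ->] : (qfact p n %| \prod_(1 <= j < n.+1) (p ^ (i + j)).-1)%N.
  by rewrite -(dvdn_pmul2r (qfact_gt0 i p1)) prod_qfact dvdn_qfactD.
have -> : (p ^ (i * n) * (c * qfact p n) ^ 2 = c ^ 2 * (p ^ (i * n) * qfact p n * qfact p n))%N.
  by ring.
rewrite dvdn_mull // dvdn_mul //.
rewrite prod_subX_lt // prod_subX_gt //.
apply: (@dvdn_trans ((p ^ i * \prod_(0 <= l < i) p ^ l * p ^ (i * (n - i))) *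
   (qfact p i * qfact p (n - i)))%N).
  by apply/dvdnP; exists 1%N; ring.
rewrite dvdn_mul //; last first.
  by have := dvdn_qfactD i (n - i) p0; rewrite subnKC.
rewrite -[X in (_ %| p ^ (i * X))%N](subnKC le_in) mulnDr expnD dvdn_mul //.
case: i le_in => [|i] _; first by rewrite big_geq.
(* Comparison of the powers of p, with i + 1 for the index: p^((i+1)^2) is p^(i+1) times i + 1
   factors p^i, and each p^l with l <= i divides p^i. *)
rewrite mulSn expnD dvdn_mul // expnM -[X in (_ ^ X)%N]subn0 -prod_nat_const_nat.
rewrite !big_mkord.
apply: (big_ind2 (fun x y => (x %| y)%N)) => // [*|l _]; first exact: dvdn_mul.
by rewrite dvdn_exp2l // -ltnS.
Qed.

Lemma absz_prod (I : Type) (r : seq I) (P : pred I) (F : I -> int) :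
  (`|(\prod_(i <- r | P i) F i)%R| = \prod_(i <- r | P i) `|F i|)%N.
Proof. exact: (big_morph _ abszM). Qed.

Lemma absz_subX p i l : (0 < p)%N ->
  (`|((p ^ i)%N%:Z - (p ^ l)%N%:Z)%R| = if l < i then p ^ i - p ^ l else p ^ l - p ^ i)%N.
Proof.
move=> p0; case: ltnP => [li|il].
  have : (p ^ l <= p ^ i)%N by rewrite leq_pexp2l // ltnW.
  by lia.
have : (p ^ i <= p ^ l)%N by rewrite leq_pexp2l.
by lia.
Qed.

Lemma absz_prod_subX p n (i : 'I_n.+1) : (0 < p)%N ->
  (`|(\prod_(l < n.+1 | l != i) ((p ^ i)%N%:Z - (p ^ l)%N%:Z))%R| =
   \prod_(0 <= l < i) (p ^ i - p ^ l) * \prod_(i.+1 <= l < n.+1) (p ^ l - p ^ i))%N.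
Proof.
move=> p0; rewrite absz_prod.
rewrite -(big_mkord (fun l => l != i) (fun l => `|((p ^ i)%N%:Z - (p ^ l)%N%:Z)%R|%N)).
rewrite (big_cat_nat (n := i)) //=; last exact: ltnW.
rewrite [X in (_ * X)%N]big_ltn_cond // eqxx /=; congr (_ * _)%N.
  rewrite big_nat_cond [RHS]big_nat_cond; apply: eq_big => l.
    by case: ltngtP.
  by case/andP => /andP[_ li] _; rewrite absz_subX // li.
rewrite big_nat_cond [RHS]big_nat_cond; apply: eq_big => l.
  by case: ltngtP.
by case/andP => /andP[li _] _; rewrite absz_subX // ltnNge ltnW.
Qed.

(** * Partial fractions with simple poles, and their derivatives *)

Definition pf_coef (F : fieldType) n (a : 'I_n -> F) (A : {poly F}) (i : 'I_n) : F :=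
  A.[a i] / \prod_(l < n | l != i) (a i - a l).

Lemma horner_prodXsubC (F : fieldType) n (a : 'I_n -> F) (P : pred 'I_n) x :
  (\prod_(l < n | P l) ('X - (a l)%:P)).[x] = \prod_(l < n | P l) (x - a l).
Proof. by rewrite horner_prod; apply: eq_bigr => l _; rewrite !hornerE. Qed.

(** [pf_coef] is the residue at a simple pole. The difference of the two sides has degree less than
    n and vanishes at the n distinct points [a i], hence it is zero. *)
Lemma partial_fraction (F : fieldType) n (a : 'I_n -> F) (A S : {poly F}) :
  injective a -> (size (A - S * \prod_(i < n) ('X - (a i)%:P))%R <= n)%N ->
  A = S * \prod_(i < n) ('X - (a i)%:P) +
    \sum_(i < n) pf_coef a A i *: \prod_(l < n | l != i) ('X - (a l)%:P).
Proof.
move=> inj_a szA; set B := \prod_(i < n) _ in szA *.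
apply/eqP; rewrite -subr_eq0 opprD addrA; apply/eqP.
apply: (@roots_geq_poly_eq0 _ _ [seq a i | i <- enum 'I_n]).
- apply/allP => _ /mapP[i _ ->]; rewrite /root !hornerE.
  have -> : B.[a i] = 0 by rewrite /B (bigD1 i) //= !hornerE subrr mul0r.
  rewrite mulr0 subr0 horner_sum (bigD1 i) //= hornerZ horner_prodXsubC.
  rewrite divfK; last by apply/prodf_neq0 => l li; rewrite subr_eq0 (inj_eq inj_a) eq_sym.
  rewrite big1 ?addr0 ?subrr // => l li.
  by rewrite hornerZ horner_prodXsubC (bigD1 i) 1?eq_sym //= subrr mul0r mulr0.
- by rewrite map_inj_uniq ?enum_uniq.
rewrite size_map size_enum_ord; apply: leq_trans (size_polyD _ _) _.
rewrite geq_max szA size_polyN; apply: leq_trans (size_sum _ _ _) _.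
apply/bigmax_leqP => i _; apply: leq_trans (size_scale_leq _ _) _.
rewrite -big_filter size_prod_XsubC size_filter.
have := count_predC (pred1 i) (index_enum 'I_n).
rewrite count_uniq_mem ?index_enum_uniq // mem_index_enum add1n => /= ->.
by rewrite -sum1_size sum_nat_const card_ord muln1.
Qed.

Section eval.
Variables (F : fieldType) (n : nat) (a : 'I_n -> F) (A S : {poly F}).
Hypotheses (inj_a : injective a)
  (szA : (size (A - S * \prod_(i < n) ('X - (a i)%:P))%R <= n)%N).
Variable x : F.
Hypothesis xa : forall i, x != a i.
Let B := \prod_(i < n) ('X - (a i)%:P).
Let Bi i := \prod_(l < n | l != i) ('X - (a l)%:P).

Let BE i : B = ('X - (a i)%:P) * Bi i. Proof. by rewrite /B (bigD1 i). Qed.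
Let xa0 i : x - a i != 0. Proof. by rewrite subr_eq0. Qed.
Let B0 : B.[x] != 0.
Proof. by rewrite /B horner_prodXsubC; apply/prodf_neq0. Qed.

Lemma horner_partial_fraction :
  A.[x] / B.[x] = S.[x] + \sum_(i < n) pf_coef a A i / (x - a i).
Proof.
rewrite {1}(partial_fraction inj_a szA) -/B hornerD hornerM horner_sum mulrDl mulfK //.
congr (_ + _); rewrite mulr_suml; apply: eq_bigr => i _.
rewrite hornerZ -/(Bi i) (BE i) hornerM hornerXsubC -mulrA; congr (_ * _).
rewrite invfM mulrCA mulfV ?mulr1 //.
by move: B0; rewrite (BE i) hornerM mulf_eq0 negb_or => /andP[].
Qed.

(** The left side is the derivative of A / B written out by the quotient rule, so that only
    polynomials have to be differentiated. *)
Lemma deriv_partial_fraction :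
  (A^`().[x] * B.[x] - A.[x] * B^`().[x]) / B.[x] ^+ 2 =
  S^`().[x] - \sum_(i < n) pf_coef a A i / (x - a i) ^+ 2.
Proof.
rewrite {1 2}(partial_fraction inj_a szA) -/B.
set g := pf_coef a A.
(* The quotient rule is linear in the numerator: the part S * B contributes S', and each [Bi i]
   contributes the derivative of 1 / (x - a_i). *)
transitivity (S^`().[x] + \sum_(i < n) g i * (((Bi i)^`().[x] * B.[x] - (Bi i).[x] * B^`().[x]) / B.[x] ^+ 2)).
  have -> : \sum_(i < n) g i * (((Bi i)^`().[x] * B.[x] - (Bi i).[x] * B^`().[x]) / B.[x] ^+ 2) =
    ((\sum_(i < n) g i * (Bi i)^`().[x]) * B.[x] - (\sum_(i < n) g i * (Bi i).[x]) * B^`().[x]) / B.[x] ^+ 2.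
    rewrite !mulr_suml -sumrB mulr_suml; apply: eq_bigr => i _; ring.
  have dE : (\sum_(i < n) g i *: Bi i)^`().[x] = \sum_(i < n) g i * (Bi i)^`().[x].
    by rewrite raddf_sum horner_sum; apply: eq_bigr => i _; rewrite /= derivZ hornerZ.
  have hE : (\sum_(i < n) g i *: Bi i).[x] = \sum_(i < n) g i * (Bi i).[x].
    by rewrite horner_sum; apply: eq_bigr => i _; rewrite hornerZ.
  by rewrite derivD derivM !hornerD !hornerM dE hE; field.
congr (_ + _); rewrite -sumrN; apply: eq_bigr => i _.
apply: etrans (mulrN _ _); congr (_ * _).
have := B0; rewrite (BE i) derivM derivXsubC mul1r hornerD !hornerM hornerXsubC.
rewrite mulf_eq0 negb_or => /andP[].
move: (Bi i).[x] (Bi i)^`().[x] (x - a i) => u v y y0 u0.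
by field; rewrite y0 u0.
Qed.
End eval.

(** * Logarithmic derivatives of polynomials *)

Section dlog.
Variable F : fieldType.
Definition dlog (f : {poly F}) x := f^`().[x] / f.[x].

Lemma dlogM f g x : f.[x] != 0 -> g.[x] != 0 -> dlog (f * g) x = dlog f x + dlog g x.
Proof. by move=> f0 g0; rewrite /dlog derivM !hornerE; field; rewrite f0 g0. Qed.

Lemma dlogXn f x k : f.[x] != 0 -> dlog (f ^+ k) x = k%:R * dlog f x.
Proof.
move=> f0; elim: k => [|k IH]; first by rewrite /dlog (derivC 1) horner0 !mul0r.
by rewrite exprS dlogM // ?IH ?horner_exp ?expf_neq0 // -natr1 mulrDl mul1r addrC.
Qed.

Lemma dlog_prod (I : Type) (r : seq I) (P : pred I) (f : I -> {poly F}) x :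
  (forall i, P i -> (f i).[x] != 0) ->
  dlog (\prod_(i <- r | P i) f i) x = \sum_(i <- r | P i) dlog (f i) x.
Proof.
(* The induction must also carry that the partial product does not vanish at x, which [dlogM]
   requires. *)
move=> f0; pose K (g : {poly F}) s := g.[x] != 0 /\ dlog g x = s.
suff [] : K (\prod_(i <- r | P i) f i) (\sum_(i <- r | P i) dlog (f i) x) by [].
apply: (big_ind2 K) => [|g s h t [g0 <-] [h0 <-]|i Pi]; rewrite /K.
- by rewrite /dlog (derivC 1) horner0 mul0r (hornerC 1) oner_eq0.
- by rewrite dlogM // hornerM mulf_neq0.
- by rewrite f0.
Qed.
End dlog.

(** * The approximating rational function *)

(* The sign compensates for using the monic denominator prod (x - p^i). *)
Definition numer_poly (R : comNzRingType) (p n : nat) : {poly R} :=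
  (-1) ^+ n.+1 * 'X^n * \prod_(1 <= j < n.+1) ((p ^ j)%:R *: 'X - 1) ^+ 2.

Definition denom_poly (R : comNzRingType) (p n : nat) : {poly R} :=
  \prod_(i < n.+1) ('X - ((p ^ i)%:R)%:P).

Lemma map_numer_poly (R R' : comNzRingType) (f : {rmorphism R -> R'}) p n :
  map_poly f (numer_poly R p n) = numer_poly R' p n.
Proof.
rewrite /numer_poly !rmorphM /= rmorphXn rmorphN1 map_polyXn rmorph_prod; congr (_ * _).
apply: eq_bigr => j _.
by rewrite rmorphXn rmorphB rmorph1 /= map_polyZ /= map_polyX rmorph_nat.
Qed.

Lemma map_denom_poly (R R' : comNzRingType) (f : {rmorphism R -> R'}) p n :
  map_poly f (denom_poly R p n) = denom_poly R' p n.
Proof.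
rewrite /denom_poly rmorph_prod; apply: eq_bigr => j _.
by rewrite rmorphB /= map_polyX map_polyC /= rmorph_nat.
Qed.

Lemma monic_denom_poly (R : comNzRingType) p n : denom_poly R p n \is monic.
Proof. exact: monic_prod_XsubC. Qed.

Lemma size_denom_poly (R : comNzRingType) p n : size (denom_poly R p n) = n.+2.
Proof. by rewrite size_prod_XsubC -sum1_size sum_nat_const card_ord muln1. Qed.

Lemma size_numer_poly (R : comNzRingType) p n : (size (numer_poly R p n) <= (3 * n).+1)%N.
Proof.
rewrite /numer_poly -mulrA -signr_odd mulr_sign.
have H : (size ('X^n * \prod_(1 <= j < n.+1) ((p ^ j)%:R *: 'X - 1) ^+ 2 : {poly R})%R
   <= (3 * n).+1)%N.
  have K m : (size (\prod_(1 <= j < m.+1) ((p ^ j)%:R *: 'X - 1) ^+ 2 : {poly R})%R <= (2 * m).+1)%N.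
    elim: m => [|m IH]; first by rewrite big_geq // size_poly1.
    have s1 : (size ((p ^ m.+1)%:R *: 'X - 1 : {poly R})%R <= 2)%N.
      apply: leq_trans (size_polyD _ _) _; rewrite size_polyN size_poly1 geq_max andbT.
      by apply: leq_trans (size_scale_leq _ _) _; rewrite size_polyX.
    have s2 : (size (((p ^ m.+1)%:R *: 'X - 1) ^+ 2 : {poly R})%R <= 3)%N.
      rewrite expr2; apply: leq_trans (size_polyMleq _ _) _.
      by have := leq_add s1 s1; case: (_ + _)%N.
    rewrite big_nat_recr //=; apply: leq_trans (size_polyMleq _ _) _.
    rewrite -subn1.
    apply: leq_trans (leq_sub2r 1 (leq_add IH s2)) _; lia.
  apply: leq_trans (size_polyMleq _ _) _; rewrite size_polyXn -subn1.
  by apply: leq_trans (leq_sub2r 1 (leq_add (leqnn n.+1) (K n))) _; lia.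
by case: odd; rewrite ?size_polyN.
Qed.

(** The division takes place over the integers, which is possible because the denominator is monic;
    the polynomial part therefore has integral coefficients. *)
Definition quot_poly p n : {poly int} :=
  Pdiv.CommonRing.rdivp (numer_poly int p n) (denom_poly int p n).

Lemma size_numer_subMquot p n :
  (size (numer_poly int p n - quot_poly p n * denom_poly int p n)%R <= n.+1)%N.
Proof.
have mB := monic_denom_poly int p n.
rewrite /quot_poly {1}[numer_poly int p n](Pdiv.RingMonic.rdivp_eq mB) addrC addKr.
by rewrite -ltnS -(size_denom_poly int p n) Pdiv.CommonRing.ltn_rmodpN0 // monic_neq0.
Qed.

(** The degree is at most 3n - (n + 1) = 2n - 1. Hence only the denominators p^k - 1 with k < 2n
    arise when the polynomial part is summed. *)
Lemma size_quot_poly p n : (size (quot_poly p n) <= n.*2)%N.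
Proof.
have [->|S0] := eqVneq (quot_poly p n) 0; first by rewrite size_poly0.
have mB := monic_denom_poly int p n.
have : (size (quot_poly p n * denom_poly int p n)%R <= (3 * n).+1)%N.
  have -> : quot_poly p n * denom_poly int p n =
      numer_poly int p n - (numer_poly int p n - quot_poly p n * denom_poly int p n) by rewrite subKr.
  apply: leq_trans (size_polyD _ _) _; rewrite size_polyN geq_max size_numer_poly.
  by apply: leq_trans (size_numer_subMquot p n) _; lia.
by rewrite size_Mmonic // size_denom_poly; lia.
Qed.

Lemma horner_numer_poly (R : comNzRingType) p n (x : R) :
  (numer_poly R p n).[x] = (-1) ^+ n.+1 * x ^+ n * \prod_(1 <= j < n.+1) ((p ^ j)%:R * x - 1) ^+ 2.
Proof.
rewrite /numer_poly !hornerM horner_prod hornerXn horner_exp hornerN (hornerC 1); congr (_ * _).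
by apply: eq_bigr => j _; rewrite !hornerE.
Qed.

Lemma absz_numer_poly p n i : (0 < p)%N ->
  `|(numer_poly int p n).[(p ^ i)%:R]|%N = (p ^ (i * n) * (\prod_(1 <= j < n.+1) (p ^ (i + j)).-1) ^ 2)%N.
Proof.
move=> p0; rewrite horner_numer_poly !abszM !abszX expnM absz_prod /= exp1n mul1n.
rewrite natz absz_nat; congr (_ * _)%N.
rewrite [RHS](big_morph (fun x => x ^ 2)%N (fun x y => expnMn x y 2) (exp1n 2)).
apply: eq_bigr => j _; rewrite abszX natz -PoszM -expnD addnC.
congr (_ ^ 2)%N; have : (0 < p ^ (i + j))%N by rewrite expn_gt0 p0.
by move: (p ^ (i + j))%N => m; lia.
Qed.

(** The factor p^i is split off because p^i / (p^i - q^t) = 1 / (1 - q^(i+t)), and [qfact p n]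
    because it later clears one factor of squared denominators. *)
Lemma pf_coef_int (F : numFieldType) p n (i : 'I_n.+1) : (1 < p)%N ->
  exists g : int, pf_coef (fun l : 'I_n.+1 => (p ^ l)%:R) (numer_poly F p n) i =
     (p ^ i * qfact p n)%:R * g%:~R.
Proof.
move=> p1; have p0 := ltnW p1.
set E : int := \prod_(l < n.+1 | l != i) ((p ^ i)%N%:Z - (p ^ l)%N%:Z).
have /dvdzP[g Eg] : (((p ^ i * qfact p n)%N%:Z * E)%R %| (numer_poly int p n).[(p ^ i)%:R])%Z.
  rewrite dvdzE absz_numer_poly // abszM absz_nat absz_prod_subX // mulnAC.
  by apply: dvdn_residue => //; rewrite -ltnS.
exists g; rewrite /pf_coef -(@map_numer_poly _ _ (intr : {rmorphism int -> F})).
have -> : ((p ^ i)%:R : F) = ((p ^ i)%:R : int)%:~R by rewrite rmorph_nat.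
rewrite horner_map /= Eg.
have -> : \prod_(l < n.+1 | l != i) (((p ^ i)%:R : int)%:~R - (p ^ l)%:R) = E%:~R :> F.
  rewrite /E rmorph_prod; apply: eq_bigr => l _.
  by rewrite rmorphB /= natz.
have E0 : E != 0.
  apply/prodf_neq0 => l li; rewrite subr_eq0.
  by rewrite eqz_nat eqn_exp2l // eq_sym.
by clearbody E; rewrite !intrM mulrA mulfK ?intr_eq0 // mulrC.
Qed.

(** * Sums over the positive integers *)

Local Open Scope classical_set_scope.

Section series_from_1.
Variable R : realType.
Implicit Types (u v : nat -> R) (l m x : R).

Definition sums_to u l := \sum_(1 <= t < M) u t @[M --> \oo] --> l.

Lemma sums_toD u v l m : sums_to u l -> sums_to v m -> sums_to (fun t => u t + v t) (l + m).
Proof.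
move=> ul vm; rewrite /sums_to.
under eq_fun do rewrite big_split; exact: cvgD.
Qed.

Lemma sums_toZ u l x : sums_to u l -> sums_to (fun t => x * u t) (x * l).
Proof.
move=> ul; rewrite /sums_to.
under eq_fun do rewrite -mulr_sumr; exact: cvgMl_tmp.
Qed.

Lemma sums_to_sum (I : Type) (r : seq I) (P : pred I) (f : I -> nat -> R) (g : I -> R) :
  (forall i, P i -> sums_to (f i) (g i)) ->
  sums_to (fun t => \sum_(i <- r | P i) f i t) (\sum_(i <- r | P i) g i).
Proof.
move=> fg; elim: r => [|i r IH].
  rewrite /sums_to big_nil; under eq_fun do under eq_bigr do rewrite big_nil.
  by under eq_fun do rewrite big1_eq; exact: cvg_cst.
rewrite big_cons; under [X in sums_to X]eq_fun do rewrite big_cons.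
by case: ifP => // Pi; apply: sums_toD => //; exact: fg.
Qed.

Lemma eq_sums_to u v l : (forall t, (0 < t)%N -> u t = v t) -> sums_to u l -> sums_to v l.
Proof.
move=> uv; rewrite /sums_to.
rewrite (_ : (fun M => \sum_(1 <= t < M) u t) = (fun M => \sum_(1 <= t < M) v t)) //.
by apply/funext => M; apply: eq_big_nat => t /andP[t0 _]; exact: uv.
Qed.

Lemma sums_to_shift u l i : sums_to u l ->
  sums_to (fun t => u (i + t)%N) (l - \sum_(1 <= j < i.+1) u j).
Proof.
move=> ul; rewrite /sums_to -(cvg_shiftn 1).
have E : (fun M => \sum_(1 <= t < M + 1) u (i + t)%N) =
   (fun M => \sum_(1 <= t < M + i.+1) u t - \sum_(1 <= j < i.+1) u j).
  apply/funext => M; rewrite [X in _ = X - _](big_cat_nat _ (n := i.+1)) ?leq_addl //=.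
  rewrite [RHS]addrAC subrr add0r -(add1n i) big_addn addnA addnK.
  by apply: eq_bigr => t _; rewrite addnC.
rewrite E; apply: cvgB; last exact: cvg_cst.
by move: ul; rewrite /sums_to -(cvg_shiftn i.+1).
Qed.

Lemma sums_to_geo x : 0 <= x < 1 -> sums_to (fun t => x ^+ t) (x / (1 - x)).
Proof.
move=> /andP[x0 x1]; rewrite /sums_to -(cvg_shiftn 1).
have := @cvg_geometric_series R x x; rewrite ger0_norm // => /(_ x1).
apply: cvg_trans; apply: near_eq_cvg; apply: nearW => M.
rewrite /series /= addn1 big_add1 /=; apply: eq_bigr => i _; by rewrite /= exprS.
Qed.

Lemma sums_to_ge u l M : (forall t, (0 < t)%N -> 0 <= u t) -> sums_to u l ->
  \sum_(1 <= t < M) u t <= l.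
Proof.
move=> u0 ul; rewrite -(cvg_lim _ ul) //.
apply: nondecreasing_cvgn_le; last by apply/cvg_ex; exists l.
by apply: nondecreasing_series => n n0 _; exact: u0.
Qed.

Lemma ler_sums_to u v l m : (forall t, (0 < t)%N -> u t <= v t) ->
  sums_to u l -> sums_to v m -> l <= m.
Proof.
move=> uv ul vm; rewrite -subr_ge0.
have H : sums_to (fun t => v t + -1 * u t) (m - l).
  by rewrite -[- l]mulN1r; apply: sums_toD => //; exact: sums_toZ.
have := sums_to_ge 0 _ H; rewrite big_geq //; apply => t t0.
by rewrite mulN1r subr_ge0 uv.
Qed.

(** The limit is written in the form to which the infinite sums in [zetaq1] and [zetaq2] unfold. *)
Lemma sums_to_bounded u c : (forall t, (0 < t)%N -> 0 <= u t) ->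
  (forall M, \sum_(1 <= t < M) u t <= c) ->
  sums_to u (limn (fun M => \sum_(1 <= t < M) u t)).
Proof.
move=> u0 uc; apply: nondecreasing_is_cvgn; first by apply: nondecreasing_series => n n0 _; exact: u0.
by exists c => _ [M _ <-].
Qed.

End series_from_1.

(** * The two zeta series *)

Section lambert.
Variable R : realType.
Implicit Types x q : R.

Lemma sum_geo x M : x != 1 -> \sum_(1 <= m < M.+1) x ^+ m = (x - x ^+ M.+1) / (1 - x).
Proof.
move=> x1; have x10 : 1 - x != 0 by rewrite subr_eq0 eq_sym.
elim: M => [|M IH]; first by rewrite big_geq // expr1 subrr mul0r.
by rewrite big_nat_recr //= IH !exprS; field.
Qed.

Lemma sum_arith_geo x M : x != 1 -> \sum_(1 <= m < M.+1) m%:R * x ^+ m =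
  (x - M.+1%:R * x ^+ M.+1 + M%:R * x ^+ M.+2) / (1 - x) ^+ 2.
Proof.
move=> x1; have x10 : 1 - x != 0 by rewrite subr_eq0 eq_sym.
elim: M => [|M IH]; first by rewrite big_geq // expr1 !mul1r subrr mul0r add0r mul0r.
by rewrite big_nat_recr //= IH -!natr1 !exprS; field.
Qed.

Lemma sum_geo_le x M : 0 <= x < 1 -> \sum_(1 <= m < M) x ^+ m <= x / (1 - x).
Proof.
move=> /andP[x0 x1]; case: M => [|M].
  by rewrite big_geq // divr_ge0 // subr_ge0 ltW.
rewrite sum_geo ?lt_eqF // ler_pM2r ?invr_gt0 ?subr_gt0 //.
by rewrite gerBl exprn_ge0.
Qed.

Lemma sum_arith_geo_le x M : 0 <= x < 1 ->
  \sum_(1 <= m < M) m%:R * x ^+ m <= x / (1 - x) ^+ 2.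
Proof.
move=> /andP[x0 x1]; case: M => [|M].
  by rewrite big_geq // divr_ge0 // exprn_ge0 // subr_ge0 ltW.
rewrite sum_arith_geo ?lt_eqF // ler_pM2r ?invr_gt0 ?exprn_gt0 ?subr_gt0 //.
rewrite -addrA gerDl -natr1 [x ^+ M.+2]exprS.
have h : 0 <= x ^+ M.+1 by rewrite exprn_ge0.
have hM : 0 <= M%:R :> R by [].
rewrite mulrDl mul1r mulrCA; set y := M%:R * _.
have : x * y <= y by rewrite ler_piMl ?mulr_ge0 // ltW.
lra.
Qed.

(** These are the terms of a convergent series: its partial sums increase and are bounded by x / (1
    - x)^2. *)
Lemma cvg_nat_geo x : 0 <= x < 1 -> M%:R * x ^+ M @[M --> \oo] --> (0 : R).
Proof.
move=> x01; have /andP[x0 x1] := x01.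
apply: cvg_series_cvg_0; apply: nondecreasing_is_cvgn.
  by apply: nondecreasing_series => n _ _; rewrite mulr_ge0 ?exprn_ge0.
exists (x / (1 - x) ^+ 2) => _ [M _ <-]; rewrite /series /=.
case: M => [|M]; first by rewrite big_geq // divr_ge0 // exprn_ge0 // subr_ge0 ltW.
by rewrite big_ltn // mul0r add0r sum_arith_geo_le.
Qed.

Lemma exprn_gt0_le q n : 0 < q < 1 -> (0 < n)%N -> 0 < q ^+ n <= q.
Proof.
move=> /andP[q0 q1] n0; rewrite exprn_gt0 //=.
by rewrite -[leRHS]expr1 ler_wiXn2l // ltW.
Qed.

Lemma sums_to_zetaq1 q : 0 < q < 1 ->
  sums_to (fun t => q ^+ t / (1 - q ^+ t)) (zetaq1 q).
Proof.
move=> q01; have /andP[q0 q1] := q01.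
apply: (@sums_to_bounded _ _ (q / (1 - q) / (1 - q))) => [t t0|M].
  have /andP[h1 h2] := exprn_gt0_le q01 t0.
  by rewrite divr_ge0 ?subr_ge0 ?(ltW h1) // (le_trans h2) // ltW.
apply: (@le_trans _ _ (\sum_(1 <= t < M) q ^+ t / (1 - q))).
  apply: ler_sum_nat => t /andP[t0 _]; have /andP[h1 h2] := exprn_gt0_le q01 t0.
  by rewrite ler_pM2l // lef_pV2 ?posrE ?subr_gt0 ?(le_lt_trans h2) // lerB.
rewrite -mulr_suml ler_pM2r ?invr_gt0 ?subr_gt0 // sum_geo_le //.
by rewrite (ltW q0).
Qed.

Let lambert_lhs q M := \sum_(1 <= n < M.+1) q ^+ n / (1 - q ^+ n) ^+ 2.
Let lambert_rhs q M := \sum_(1 <= n < M.+1) n%:R * q ^+ n / (1 - q ^+ n).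
Let lambert_sq q M := \sum_(1 <= n < M.+1) \sum_(1 <= m < M.+1) m%:R * q ^+ (n * m).

(* The Lambert identity sum q^n/(1-q^n)^2 = sum n q^n/(1-q^n): both partial sums
   are compared with the square partial sum of the double series of m q^(nm). *)
Lemma lambert_lhs_bound q M : 0 < q < 1 ->
  0 <= lambert_lhs q M - lambert_sq q M <= M.+1%:R * q ^+ M.+1 / (1 - q) ^+ 3.
Proof.
move=> q01; have /andP[q0 q1] := q01.
have q1' : 0 < 1 - q by rewrite subr_gt0.
(* With y = q^n, the summand is the tail over m > M of the series of m y^m, in closed form. *)
have E : lambert_lhs q M - lambert_sq q M = \sum_(1 <= n < M.+1)
    (M.+1%:R * (q ^+ n) ^+ M.+1 - M%:R * (q ^+ n) ^+ M.+2) / (1 - q ^+ n) ^+ 2.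
  rewrite /lambert_lhs /lambert_sq -sumrB; apply: eq_big_nat => n /andP[n0 _].
  have /andP[h1 h2] := exprn_gt0_le q01 n0.
  under eq_bigr do rewrite exprM.
  rewrite sum_arith_geo; last by rewrite lt_eqF // (le_lt_trans h2).
  by ring.
(* Each tail is bounded by a term of a geometric progression in n with ratio q^(M+1). *)
have T n : (0 < n)%N -> 0 <= (M.+1%:R * (q ^+ n) ^+ M.+1 - M%:R * (q ^+ n) ^+ M.+2) / (1 - q ^+ n) ^+ 2
    <= M.+1%:R / (1 - q) ^+ 2 * (q ^+ M.+1) ^+ n.
  move=> n0; have /andP[h1 h2] := exprn_gt0_le q01 n0.
  have h3 : 0 < 1 - q ^+ n by lra.
  have -> : (q ^+ M.+1) ^+ n = (q ^+ n) ^+ M.+1 by rewrite -!exprM mulnC.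
  move: h1 h2 h3; set y := q ^+ n => h1 h2 h3.
  have k1 : 0 <= M%:R * y ^+ M.+2 by rewrite mulr_ge0 // exprn_ge0 // ltW.
  have k2 : M%:R * y ^+ M.+2 <= M.+1%:R * y ^+ M.+1.
    apply: ler_pM => //; first by rewrite exprn_ge0 // ltW.
      by rewrite ler_nat.
    by rewrite ler_wiXn2l ?(ltW h1) //; lra.
  rewrite divr_ge0 ?subr_ge0 ?exprn_ge0 ?(ltW h3) //= mulrAC.
  apply: ler_pM => //; first by rewrite subr_ge0.
  - by rewrite invr_ge0 exprn_ge0 // ltW.
  - by rewrite gerBl.
  - by rewrite lef_pV2 ?posrE ?exprn_gt0 // ler_pXn2r ?nnegrE //; lra.
rewrite E; apply/andP; split.
  by rewrite big_nat sumr_ge0 // => n /andP[n0 _]; case/andP: (T n n0).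
apply: (@le_trans _ _ (\sum_(1 <= n < M.+1) M.+1%:R / (1 - q) ^+ 2 * (q ^+ M.+1) ^+ n)).
  by apply: ler_sum_nat => n /andP[n0 _]; case/andP: (T n n0).
have /andP[h1 h2] := exprn_gt0_le q01 (ltn0Sn M).
rewrite -mulr_sumr; apply: (@le_trans _ _ (M.+1%:R / (1 - q) ^+ 2 * (q ^+ M.+1 / (1 - q ^+ M.+1)))).
  rewrite ler_wpM2l ?divr_ge0 ?exprn_ge0 ?(ltW q1') // sum_geo_le // (ltW h1) /=; lra.
have -> : M.+1%:R * q ^+ M.+1 / (1 - q) ^+ 3 = M.+1%:R / (1 - q) ^+ 2 * (q ^+ M.+1 / (1 - q)).
  by field; rewrite gt_eqF.
rewrite ler_wpM2l ?divr_ge0 ?exprn_ge0 ?(ltW q1') // ler_pM2l // lef_pV2 ?posrE //; lra.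
Qed.

Lemma lambert_rhs_bound q M : 0 < q < 1 ->
  0 <= lambert_rhs q M - lambert_sq q M <= q ^+ M.+1 / (1 - q) ^+ 3.
Proof.
move=> q01; have /andP[q0 q1] := q01.
have q1' : 0 < 1 - q by rewrite subr_gt0.
have E : lambert_rhs q M - lambert_sq q M = \sum_(1 <= n < M.+1)
    n%:R * (q ^+ M.+1) ^+ n / (1 - q ^+ n).
  (* Summing the square in the other order turns the inner sum into a plain geometric one, whose
     tail remains. *)
  rewrite /lambert_rhs /lambert_sq [X in _ - X]exchange_big -sumrB /=.
  apply: eq_big_nat => n /andP[n0 _].
  have /andP[h1 h2] := exprn_gt0_le q01 n0.
  under eq_bigr do rewrite mulnC exprM.
  rewrite -mulr_sumr sum_geo; last by rewrite lt_eqF // (le_lt_trans h2).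
  by rewrite -[(q ^+ M.+1) ^+ n]exprM mulnC exprM; ring.
have /andP[g1 g2] := exprn_gt0_le q01 (ltn0Sn M).
have T n : (0 < n)%N -> 0 <= n%:R * (q ^+ M.+1) ^+ n / (1 - q ^+ n)
    <= (1 - q)^-1 * (n%:R * (q ^+ M.+1) ^+ n).
  move=> n0; have /andP[h1 h2] := exprn_gt0_le q01 n0.
  have h3 : 0 < 1 - q ^+ n by lra.
  have k : 0 <= n%:R * (q ^+ M.+1) ^+ n by rewrite mulr_ge0 // exprn_ge0 // ltW.
  rewrite divr_ge0 ?(ltW h3) //= mulrC ler_wpM2r // lef_pV2 ?posrE //; lra.
rewrite E; apply/andP; split.
  by rewrite big_nat sumr_ge0 // => n /andP[n0 _]; case/andP: (T n n0).
apply: (@le_trans _ _ (\sum_(1 <= n < M.+1) (1 - q)^-1 * (n%:R * (q ^+ M.+1) ^+ n))).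
  by apply: ler_sum_nat => n /andP[n0 _]; case/andP: (T n n0).
rewrite -mulr_sumr; apply: (@le_trans _ _ ((1 - q)^-1 * (q ^+ M.+1 / (1 - q ^+ M.+1) ^+ 2))).
  rewrite ler_wpM2l ?invr_ge0 ?(ltW q1') // sum_arith_geo_le // (ltW g1) /=; lra.
have -> : q ^+ M.+1 / (1 - q) ^+ 3 = (1 - q)^-1 * (q ^+ M.+1 / (1 - q) ^+ 2).
  by field; rewrite gt_eqF.
rewrite ler_wpM2l ?invr_ge0 ?(ltW q1') // ler_pM2l // lef_pV2 ?posrE ?exprn_gt0 //; last lra.
rewrite ler_pXn2r ?nnegrE //; lra.
Qed.

(** The squared denominators are those that differentiating a simple pole produces, so this is the
    series that meets the second linear form. *)
Lemma sums_to_zetaq2 q : 0 < q < 1 ->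
  sums_to (fun t => q ^+ t / (1 - q ^+ t) ^+ 2) (zetaq2 q).
Proof.
move=> q01; have /andP[q0 q1] := q01.
have q1' : 0 < 1 - q by rewrite subr_gt0.
have H : sums_to (fun t => t%:R * q ^+ t / (1 - q ^+ t)) (zetaq2 q).
  apply: (@sums_to_bounded _ _ (q / (1 - q) ^+ 2 / (1 - q))) => [t t0|M].
    have /andP[h1 h2] := exprn_gt0_le q01 t0.
    by rewrite divr_ge0 ?subr_ge0 ?mulr_ge0 ?(ltW h1) // (le_trans h2) // ltW.
  apply: (@le_trans _ _ (\sum_(1 <= t < M) t%:R * q ^+ t / (1 - q))).
    apply: ler_sum_nat => t /andP[t0 _]; have /andP[h1 h2] := exprn_gt0_le q01 t0.
    rewrite ler_wpM2l ?mulr_ge0 ?(ltW h1) // lef_pV2 ?posrE; lra.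
  rewrite -mulr_suml ler_pM2r ?invr_gt0 // sum_arith_geo_le //.
  by rewrite (ltW q0).
rewrite /sums_to -(cvg_shiftn 1) /=.
have HE : (fun M => \sum_(1 <= t < M + 1) q ^+ t / (1 - q ^+ t) ^+ 2) =
   (fun M => \sum_(1 <= t < M + 1) t%:R * q ^+ t / (1 - q ^+ t) + (lambert_lhs q M - lambert_rhs q M)).
  by apply/funext => M; rewrite addn1 /lambert_rhs addrC subrK.
rewrite HE -[zetaq2 q]addr0; apply: cvgD.
  by move: H; rewrite /sums_to -(cvg_shiftn 1).
(* Both partial sums exceed the square sum by at most this quantity, which therefore squeezes their
   difference to 0. *)
have c1 : M.+1%:R * q ^+ M.+1 / (1 - q) ^+ 3 @[M --> \oo] --> (0 : R).
  rewrite -(mul0r ((1 - q) ^+ 3)^-1); apply: cvgMr_tmp.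
  have := @cvg_nat_geo q; rewrite (ltW q0) q1 => /(_ isT).
  by rewrite -(cvg_shiftn 1); under eq_fun do rewrite addn1.
have c2 : - (M.+1%:R * q ^+ M.+1 / (1 - q) ^+ 3) @[M --> \oo] --> (0 : R).
  by rewrite -oppr0; apply: cvgN.
apply: (squeeze_cvgr _ c2 c1); apply: nearW => M.
have /andP[a1 a2] := lambert_lhs_bound M q01.
have /andP[b1 b2] := lambert_rhs_bound M q01.
have b3 : q ^+ M.+1 / (1 - q) ^+ 3 <= M.+1%:R * q ^+ M.+1 / (1 - q) ^+ 3.
  rewrite ler_pM2r ?invr_gt0 ?exprn_gt0 // ler_peMl ?exprn_ge0 ?(ltW q0) //.
  by rewrite ler1n.
by apply/andP; split; lra.
Qed.
End lambert.

Definition approx (R : realType) p n (x : R) := (numer_poly R p n).[x] / (denom_poly R p n).[x].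
(* [x d/dx] applied to [approx]. *)
Definition theta_approx (R : realType) p n (x : R) :=
  x * (((numer_poly R p n)^`().[x] * (denom_poly R p n).[x] - (numer_poly R p n).[x] * (denom_poly R p n)^`().[x])
       / (denom_poly R p n).[x] ^+ 2).

(** * Size of the approximating function at the powers of q *)

Section estimates.
Variables (R : realType) (p n : nat).
Hypothesis p1 : (1 < p)%N.
Let q : R := p%:R^-1.
Let A := numer_poly R p n.
Let B := denom_poly R p n.

Lemma base_gt0 : 0 < p%:R :> R. Proof. by rewrite ltr0n ltnW. Qed.
Lemma invbase_gt0 : 0 < q. Proof. by rewrite invr_gt0 base_gt0. Qed.
Lemma invbase_le_half : q <= 2^-1.
Proof. by rewrite lef_pV2 ?posrE ?ler_nat // base_gt0. Qed.
Lemma invbase_lt1 : q < 1. Proof. by have := invbase_le_half; lra. Qed.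
Lemma invbase01 : 0 < q < 1. Proof. by rewrite invbase_gt0 invbase_lt1. Qed.
Lemma invbaseX_le_half t : (0 < t)%N -> 0 < q ^+ t <= 2^-1.
Proof.
by move=> /(exprn_gt0_le invbase01)/andP[-> h] /=; exact: le_trans invbase_le_half.
Qed.
Lemma baseX_ge1 i : 1 <= (p ^ i)%:R :> R.
Proof. by rewrite ler1n expn_gt0 ltnW. Qed.
Lemma baseX_invbaseX j t : (j <= t)%N -> (p ^ j)%:R * q ^+ t = q ^+ (t - j) :> R.
Proof.
move=> jt; rewrite -{1}(subnKC jt) exprD mulrA natrX exprVn mulfV ?mul1r //.
by rewrite expf_neq0 // gt_eqF // base_gt0.
Qed.

Lemma horner_denom_poly (F : fieldType) (x : F) :
  (denom_poly F p n).[x] = \prod_(i < n.+1) (x - (p ^ i)%:R).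
Proof. exact: (horner_prodXsubC (fun i : 'I_n.+1 => (p ^ i)%:R)). Qed.

Lemma baseX_sub_ge i t : (0 < t)%N -> (p ^ i)%:R / 2 <= (p ^ i)%:R - q ^+ t :> R.
Proof. by move=> /invbaseX_le_half/andP[_ h]; have := baseX_ge1 i; lra. Qed.

Lemma baseX_sub_gt0 i t : (0 < t)%N -> 0 < (p ^ i)%:R - q ^+ t :> R.
Proof. by move=> /invbaseX_le_half/andP[_ h]; have := baseX_ge1 i; lra. Qed.

Lemma horner_denom_poly_neq0 t : (0 < t)%N -> B.[q ^+ t] != 0.
Proof.
move=> t0; rewrite horner_denom_poly; apply/prodf_neq0 => i _.
by rewrite -oppr_eq0 opprB gt_eqF // baseX_sub_gt0.
Qed.

Lemma approxE t : approx p n (q ^+ t) = (q ^+ t) ^+ n *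
   \prod_(1 <= j < n.+1) ((p ^ j)%:R * q ^+ t - 1) ^+ 2 / \prod_(i < n.+1) ((p ^ i)%:R - q ^+ t).
Proof.
rewrite /approx horner_numer_poly horner_denom_poly.
have -> : \prod_(i < n.+1) (q ^+ t - (p ^ i)%:R) = (-1) ^+ n.+1 * \prod_(i < n.+1) ((p ^ i)%:R - q ^+ t).
  have -> : (-1) ^+ n.+1 = \prod_(i < n.+1) (-1) :> R by rewrite prodr_const card_ord.
  by rewrite -big_split; apply: eq_bigr => i _; rewrite /= mulN1r opprB.
have s0 : (-1) ^+ n.+1 != 0 :> R by rewrite signr_eq0.
by rewrite -[RHS]mul1r -[X in _ = X * _](divff s0) [RHS]mulrACA -invfM !mulrA.
Qed.

(** For t > n the squared factors are (1 - q^(t-j))^2, between 0 and 1, and each p^i - q^t is at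
    least p^i / 2; the n + 1 halves give the power of 2. *)
Lemma approx_le t : (0 < t)%N -> (n < t)%N ->
  0 < approx p n (q ^+ t) <= (q ^+ n) ^+ t * (2 ^+ n.+1 / \prod_(i < n.+1) (p ^ i)%:R).
Proof.
move=> t0 nt.
have Pj j : (1 <= j < n.+1)%N -> 0 < ((p ^ j)%:R * q ^+ t - 1) ^+ 2 <= 1.
  move=> /andP[j0 jn]; rewrite baseX_invbaseX; last by lia.
  have /andP[h1 h2] : 0 < q ^+ (t - j) <= 2^-1 by apply: invbaseX_le_half; lia.
  rewrite -sqrrN opprB; nra.
rewrite approxE; apply/andP; split.
  rewrite divr_gt0 // ?mulr_gt0 ?exprn_gt0 ?invbase_gt0 //.
    by rewrite big_nat_cond; apply: prodr_gt0 => j /andP[/Pj/andP[]].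
  by apply: prodr_gt0 => i _; exact: baseX_sub_gt0.
rewrite -[(q ^+ t) ^+ n]exprM [(t * n)%N]mulnC exprM -mulrA ler_wpM2l ?exprn_ge0 ?(ltW invbase_gt0) //.
rewrite -[leRHS]mul1r; apply: ler_pM.
- by rewrite big_nat_cond prodr_ge0 // => j /andP[/Pj/andP[/ltW]].
- by rewrite invr_ge0 prodr_ge0 // => i _; exact/ltW/baseX_sub_gt0.
- suff /andP[] : 0 <= \prod_(1 <= j < n.+1) ((p ^ j)%:R * q ^+ t - 1) ^+ 2 <= 1 by [].
  rewrite big_nat; apply: (big_ind (fun x => 0 <= x <= 1)) => [|x y|j /Pj/andP[h1 h2]].
  - by rewrite ler01 lexx.
  - by move=> /andP[? ?] /andP[? ?]; rewrite mulr_ge0 // mulr_ile1.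
  - by rewrite h2 ltW.
have -> : 2 ^+ n.+1 / \prod_(i < n.+1) (p ^ i)%:R = (\prod_(i < n.+1) ((p ^ i)%:R / 2))^-1 :> R.
  by rewrite big_split /= prodr_const card_ord exprVn invfM invrK mulrC.
rewrite lef_pV2 ?posrE; first by apply: ler_prod => i _; rewrite divr_ge0 //= baseX_sub_ge.
  by apply: prodr_gt0 => i _; exact: baseX_sub_gt0.
by apply: prodr_gt0 => i _; rewrite divr_gt0 // (lt_le_trans ltr01) // baseX_ge1.
Qed.

(** The factor (p^t x - 1)^2 of the numerator has a double zero at q^t, which kills both the
    numerator and its derivative. *)
Lemma approx_eq0 t : (0 < t <= n)%N -> approx p n (q ^+ t) = 0 :> R /\ theta_approx p n (q ^+ t) = 0 :> R.
Proof.
move=> tn; pose L : {poly R} := (p ^ t)%:R *: 'X - 1.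
have [G AG] : exists G, A = L ^+ 2 * G.
  rewrite /A /numer_poly (bigD1_seq t) ?iota_uniq ?mem_index_iota ?ltnS //=.
  by eexists; rewrite mulrCA.
have L0 : L.[q ^+ t] = 0 by rewrite !hornerE baseX_invbaseX ?subnn ?expr0 ?subrr.
clearbody L.
have A0 : A.[q ^+ t] = 0 by rewrite AG hornerM horner_exp L0 expr0n mul0r.
have A'0 : A^`().[q ^+ t] = 0.
  by rewrite AG expr2 !derivM !(hornerD, hornerM) L0 !(mul0r, mulr0, addr0).
by rewrite /approx /theta_approx -/A -/B A0 A'0 !mul0r subrr mul0r mulr0.
Qed.

(** The second factor is the logarithmic derivative times x, computed factor by factor: x^n gives n,
    the squares give the first sum and the poles the second. *)
Lemma theta_approxE t : (n < t)%N -> theta_approx p n (q ^+ t) = approx p n (q ^+ t) *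
  (n%:R - 2 * (\sum_(1 <= j < n.+1) q ^+ (t - j) / (1 - q ^+ (t - j)))
   + \sum_(i < n.+1) q ^+ t / ((p ^ i)%:R - q ^+ t)) :> R.
Proof.
move=> nt; have t0 : (0 < t)%N by apply: leq_ltn_trans nt.
set T := q ^+ t; have T0 : T != 0 by rewrite expf_neq0 // gt_eqF // invbase_gt0.
have B0 := horner_denom_poly_neq0 t0; rewrite -/T in B0.
have A0 : A.[T] != 0.
  have /andP[] := approx_le t0 nt; rewrite /approx -/A -/B -/T => h _.
  by apply: contraTneq h => ->; rewrite mul0r ltxx.
have Aj j : (1 <= j < n.+1)%N -> ((p ^ j)%:R *: 'X - 1 : {poly R}).[T] != 0.
  move=> /andP[j0 jn]; rewrite !hornerE baseX_invbaseX; last by lia.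
  have /andP[h1 h2] : 0 < q ^+ (t - j) <= 2^-1 by apply: invbaseX_le_half; lia.
  by rewrite lt_eqF //; lra.
have -> : theta_approx p n T = approx p n T * (T * dlog A T - T * dlog B T).
  by rewrite /theta_approx /approx -/A -/B /dlog; field; rewrite A0 B0.
congr (_ * _); congr (_ + _).
  have -> : dlog A T = n%:R / T +
      \sum_(1 <= j < n.+1) 2 * ((p ^ j)%:R / ((p ^ j)%:R * T - 1)).
    have N1 : (-1 : {poly R}).[T] != 0 by rewrite hornerN (hornerC 1) oppr_eq0 oner_eq0.
    have X0 : ('X : {poly R}).[T] != 0 by rewrite hornerX.
    rewrite /A /numer_poly dlogM ?dlogM ?dlogXn ?hornerM ?horner_exp ?mulf_neq0 ?expf_neq0 //;
      last first.
      rewrite horner_prod prodf_seq_neq0; apply/allP => j /=.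
      rewrite mem_index_iota => /Aj h.
      by rewrite horner_exp expf_neq0.
    congr (_ + _).
      rewrite /dlog derivN (derivC 1) oppr0 horner0 mul0r mulr0 add0r.
      by rewrite derivX (hornerC 1) hornerX mul1r.
    rewrite [X in dlog X]big_nat_cond dlog_prod; last first.
      by move=> j /andP[/Aj h _]; rewrite horner_exp expf_neq0.
    rewrite [RHS]big_nat_cond; apply: eq_bigr => j /andP[/Aj h _].
    rewrite dlogXn //; congr (_ * _).
    by rewrite /dlog derivB derivZ derivX (derivC 1) subr0 !hornerE.
  rewrite mulrDr mulrCA mulfV // mulr1; congr (_ + _).
  rewrite -[RHS]mulrN -sumrN !mulr_sumr; apply: eq_big_nat => j jn.
  have h : (p ^ j)%:R * T - 1 != 0 by have := Aj j jn; rewrite !hornerE.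
  rewrite -baseX_invbaseX -/T; last by lia.
  by rewrite -[1 - _]opprB; field.
have -> : dlog B T = \sum_(i < n.+1) (T - (p ^ i)%:R)^-1.
  rewrite /B /denom_poly dlog_prod => [|i _]; last first.
    by rewrite !hornerE -oppr_eq0 opprB gt_eqF // baseX_sub_gt0.
  by apply: eq_bigr => i _; rewrite /dlog derivXsubC (hornerC 1) !hornerE ?mul1r.
rewrite mulr_sumr -sumrN; apply: eq_bigr => i _.
by rewrite -mulrN -invrN opprB.
Qed.

(** As q <= 1/2, the first sum of [theta_approxE] is at most twice a geometric series of value at
    most 1, hence lies in [0, 2]. The n + 1 terms of the second lie in [0, 1]. So the factor lies
    between n - 4 and n + (n + 1). *)
Lemma theta_approx_bounds t : (n < t)%N ->
  (n%:R - 4) * approx p n (q ^+ t) <= theta_approx p n (q ^+ t) <= (2 * n + 1)%:R * approx p n (q ^+ t).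
Proof.
move=> nt; have t0 : (0 < t)%N by apply: leq_ltn_trans nt.
have /andP[R0 _] := approx_le t0 nt.
rewrite theta_approxE //.
set X := (_ - _ + _).
suff /andP[h1 h2] : n%:R - 4 <= X <= (2 * n + 1)%:R.
  by rewrite [_ * X]mulrC !ler_pM2r // h1 h2.
rewrite /X; set S1 := \sum_(1 <= j < n.+1) _; set S2 := \sum_(i < n.+1) _.
have S10 : 0 <= S1.
  rewrite /S1 big_nat sumr_ge0 // => j /andP[j0 jn].
  have /andP[h1 h2] : 0 < q ^+ (t - j) <= 2^-1 by apply: invbaseX_le_half; lia.
  by rewrite divr_ge0 ?(ltW h1) //; lra.
have S12 : S1 <= 2.
  apply: (@le_trans _ _ (\sum_(1 <= j < n.+1) 2 * q ^+ (n.+1 - j))).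
    apply: ler_sum_nat => j /andP[j0 jn].
    have /andP[h1 h2] : 0 < q ^+ (t - j) <= 2^-1 by apply: invbaseX_le_half; lia.
    apply: (@le_trans _ _ (2 * q ^+ (t - j))).
      by rewrite ler_pdivrMr; [nra | lra].
    rewrite ler_pM2l // ler_wiXn2l ?(ltW invbase_gt0) ?(ltW invbase_lt1) //; lia.
  rewrite -mulr_sumr big_nat_rev /=.
  have -> : \sum_(1 <= j < n.+1) q ^+ (n.+1 - (1 + n.+1 - j.+1)) = \sum_(1 <= j < n.+1) q ^+ j.
    by apply: eq_big_nat => j jn; congr (_ ^+ _); lia.
  rewrite -[leRHS]mulr1 ler_pM2l //.
  apply: (@le_trans _ _ (q / (1 - q))).
    by apply: sum_geo_le; rewrite (ltW invbase_gt0) invbase_lt1.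
  have h1 := invbase_le_half; have h2 := invbase_gt0; rewrite ler_pdivrMr ?mul1r; lra.
have S20 : 0 <= S2.
  by apply: sumr_ge0 => i _; rewrite divr_ge0 ?exprn_ge0 ?(ltW invbase_gt0) // ltW // baseX_sub_gt0.
have S22 : S2 <= n.+1%:R.
  rewrite -[n.+1 in leRHS]card_ord -sum1_card natr_sum; apply: ler_sum => i _.
  have /andP[_ h] := invbaseX_le_half t0.
  by rewrite ler_pdivrMr ?baseX_sub_gt0 // mul1r; have := baseX_ge1 i; lra.
move: S10 S12 S20 S22; rewrite natrD natrM -natr1.
move: S1 S2 => S1 S2; have : 0 <= n%:R :> R by [].
by move=> *; apply/andP; split; lra.
Qed.

End estimates.

(** The operator x d/dx multiplies x^k by k, so the constant term disappears and the sum may start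
    at k = 1. *)
Lemma horner_theta (R : comNzRingType) (f : {poly R}) m x : (size f <= m)%N ->
  x * f^`().[x] = \sum_(1 <= k < m) k%:R * f`_k * x ^+ k.
Proof.
case: m => [|m] szf.
  by move: szf; rewrite leqn0 size_poly_eq0 => /eqP ->; rewrite deriv0 horner0 mulr0 big_geq.
have szd : (size f^`() <= m)%N.
  have [->|f0] := eqVneq f 0; first by rewrite deriv0 size_poly0.
  by rewrite -ltnS (leq_trans (lt_size_deriv f0)).
rewrite (horner_coef_wide _ szd) big_add1 big_mkord mulr_sumr.
by apply: eq_bigr => k _; rewrite coef_deriv exprS -mulr_natl; ring.
Qed.

(** * The linear forms *)

Section forms.
Variables (R : realType) (p n : nat).
Hypotheses (p1 : (1 < p)%N) (n0 : (0 < n)%N).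
Let q : R := p%:R^-1.
Let A := numer_poly R p n.
Let B := denom_poly R p n.
Let S : {poly R} := map_poly intr (quot_poly p n).
Let a (i : 'I_n.+1) : R := (p ^ i)%:R.
Variable g : 'I_n.+1 -> int.
Hypothesis gP : forall i, pf_coef a A i = (p ^ i * qfact p n)%:R * (g i)%:~R.
(** Normalised so that the pole at p^i contributes b_i / (1 - q^(i+t)) at x = q^t. *)
Let b i : R := - ((qfact p n)%:R * (g i)%:~R).

Let inj_a : injective a.
Proof. by move=> i j /eqP; rewrite eqr_nat eqn_exp2l // => /eqP/val_inj. Qed.

Let szA : (size (A - S * \prod_(i < n.+1) ('X - (a i)%:P))%R <= n.+1)%N.
Proof.
rewrite /A -(@map_numer_poly _ _ (intr : {rmorphism int -> R})) -/(denom_poly R p n).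
rewrite -(@map_denom_poly _ _ (intr : {rmorphism int -> R})) /S -rmorphM -rmorphB /=.
by rewrite size_map_inj_poly ?size_numer_subMquot //; exact: intr_inj.
Qed.

Let szS : (size S <= n.*2)%N.
Proof. by rewrite size_map_inj_poly ?size_quot_poly //; exact: intr_inj. Qed.

Let q0 : 0 < q. Proof. exact: invbase_gt0. Qed.
Let pX0 i : (p ^ i)%:R != 0 :> R.
Proof. by rewrite pnatr_eq0 -lt0n expn_gt0 ltnW. Qed.
Let qXE i : q ^+ i = (p ^ i)%:R^-1. Proof. by rewrite natrX exprVn. Qed.
Let xa t (i : 'I_n.+1) : (0 < t)%N -> q ^+ t != a i.
Proof. by move=> t0; rewrite lt_eqF // -subr_gt0 baseX_sub_gt0. Qed.
Let qX1 i : (0 < i)%N -> 1 - q ^+ i != 0.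
Proof. by move=> /(invbaseX_le_half R p1)/andP[_ h]; rewrite gt_eqF //; rewrite -/q in h; lra. Qed.

(* The value 0 of the approximating function at the origin, which cancels the
   constant terms of the expansion below. *)
Let S0E : S`_0 + \sum_(i < n.+1) b i = 0.
Proof.
have x0 i : 0 != a i by rewrite eq_sym pX0.
have := horner_partial_fraction inj_a szA x0.
rewrite horner_numer_poly expr0n gtn_eqF // mulr0 !mul0r => E.
rewrite [RHS]E -horner_coef0; congr (_ + _); apply: eq_bigr => i _.
rewrite gP natrM sub0r invrN mulrN /b /a; move: (pX0 i).
by move: (p ^ i)%:R (qfact p n)%:R => x y xn0; field.
Qed.

(** Writing 1 / (1 - y) = 1 + y / (1 - y) with y = q^(i+t) splits a constant off each pole; by [S0E]
    these constants cancel that of S, and every remaining term is summable over t. *)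
Lemma approx_form t : (0 < t)%N -> approx p n (q ^+ t) =
  \sum_(1 <= k < n.*2) S`_k * (q ^+ k) ^+ t +
  \sum_(i < n.+1) b i * (q ^+ (i + t) / (1 - q ^+ (i + t))).
Proof.
move=> t0; rewrite /approx -/A (horner_partial_fraction inj_a szA (fun i => xa i t0)).
rewrite (horner_coef_wide _ szS) -(big_mkord xpredT (fun i => S`_i * q ^+ t ^+ i)).
rewrite big_ltn ?double_gt0 // expr0 mulr1.
have -> : \sum_(i < n.+1) pf_coef a A i / (q ^+ t - a i) =
    \sum_(i < n.+1) b i + \sum_(i < n.+1) b i * (q ^+ (i + t) / (1 - q ^+ (i + t))).
  rewrite -big_split; apply: eq_bigr => i _ /=.
  have := xa i t0; have := @qX1 (i + t); rewrite addn_gt0 t0 orbT => /(_ isT).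
  rewrite gP natrM /b /a exprD (qXE i); move: (pX0 i).
  move: (p ^ i)%:R (qfact p n)%:R (q ^+ t) => x y z h1 h2 h3.
  have h4 : x - z != 0 by rewrite subr_eq0 eq_sym.
  by field; rewrite h1 h4 subr_eq0 h3.
rewrite addrACA S0E add0r; congr (_ + _).
by apply: eq_bigr => k _; rewrite -!exprM mulnC.
Qed.

(** The poles carry the same coefficients [b i] as in [approx_form]; hence both zeta values receive
    the same coefficient. *)
Lemma theta_approx_form t : (0 < t)%N -> theta_approx p n (q ^+ t) =
  \sum_(1 <= k < n.*2) k%:R * S`_k * (q ^+ k) ^+ t +
  \sum_(i < n.+1) b i * (q ^+ (i + t) / (1 - q ^+ (i + t)) ^+ 2).
Proof.
move=> t0; rewrite /theta_approx -/A (deriv_partial_fraction inj_a szA (fun i => xa i t0)).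
rewrite mulrBr (horner_theta _ szS) mulr_sumr -sumrN; congr (_ + _).
  by apply: eq_bigr => k _; rewrite -!exprM mulnC.
apply: eq_bigr => i _.
have := xa i t0; have := @qX1 (i + t); rewrite addn_gt0 t0 orbT => /(_ isT).
rewrite gP natrM /b /a exprD (qXE i); move: (pX0 i).
move: (p ^ i)%:R (qfact p n)%:R (q ^+ t) => x y z h1 h2 h3.
have h4 : x - z != 0 by rewrite subr_eq0 eq_sym.
by field; rewrite h1 h4 subr_eq0 h3.
Qed.

(** The expansion [approx_form] summed over t >= 1: powers give geometric series, and the pole at
    p^i gives the tail of the zeta series beyond its first i terms. *)
Definition form1 : R := \sum_(1 <= k < n.*2) S`_k * (q ^+ k / (1 - q ^+ k)) +
  \sum_(i < n.+1) b i * (zetaq1 q - \sum_(1 <= j < i.+1) q ^+ j / (1 - q ^+ j)).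

Definition form2 : R := \sum_(1 <= k < n.*2) k%:R * S`_k * (q ^+ k / (1 - q ^+ k)) +
  \sum_(i < n.+1) b i * (zetaq2 q - \sum_(1 <= j < i.+1) q ^+ j / (1 - q ^+ j) ^+ 2).

Let geoX (c : nat -> R) : sums_to (fun t => \sum_(1 <= k < n.*2) c k * (q ^+ k) ^+ t)
  (\sum_(1 <= k < n.*2) c k * (q ^+ k / (1 - q ^+ k))).
Proof.
rewrite big_nat; under [X in sums_to X]eq_fun do rewrite big_nat.
apply: sums_to_sum => k /andP[k0 _]; apply: sums_toZ; apply: sums_to_geo.
have /andP[h1 h2] := invbaseX_le_half R p1 k0.
by rewrite (ltW h1) (le_lt_trans h2) //; lra.
Qed.

Lemma sums_to_approx : sums_to (fun t => approx p n (q ^+ t)) form1.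
Proof.
apply: (eq_sums_to (fun t t0 => esym (approx_form t0))).
apply: sums_toD; first exact: geoX.
apply: sums_to_sum => i _; apply: sums_toZ.
exact: (@sums_to_shift _ (fun t => q ^+ t / (1 - q ^+ t)) _ i (sums_to_zetaq1 (invbase01 R p1))).
Qed.

Lemma sums_to_theta_approx : sums_to (fun t => theta_approx p n (q ^+ t)) form2.
Proof.
apply: (eq_sums_to (fun t t0 => esym (theta_approx_form t0))).
apply: sums_toD; first exact: geoX.
apply: sums_to_sum => i _; apply: sums_toZ.
exact: (@sums_to_shift _ (fun t => q ^+ t / (1 - q ^+ t) ^+ 2) _ i (sums_to_zetaq2 (invbase01 R p1))).
Qed.

(* Every k < 2n has a multiple in [n, 2n), so D is a multiple of all p^k - 1 with
   k < 2n, while being much smaller than their product. *)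
Let D : R := (\prod_(n <= k < n.*2) (p ^ k).-1)%N%:R.

Let natr_pred k : ((p ^ k).-1)%:R = (p ^ k)%:R - 1 :> R.
Proof. by rewrite -subn1 natrB // expn_gt0 ltnW. Qed.

Let predX_neq0 k : (0 < k)%N -> (p ^ k)%:R - 1 != 0 :> R.
Proof. by move=> k0; rewrite -natr_pred pnatr_eq0 -lt0n predX_gt0. Qed.

Let int_natr_div (d m : nat) : (0 < d)%N -> (d %| m)%N -> m%:R / d%:R \is a @Num.int R.
Proof.
move=> d0 /dvdnP[c ->]; rewrite natrM mulfK ?pnatr_eq0 -?lt0n //.
Qed.

Let intD k : (0 < k < n.*2)%N -> D / ((p ^ k)%:R - 1) \is a Num.int.
Proof.
move=> kn; rewrite -natr_pred; apply: int_natr_div; last exact: dvdn_window.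
by apply: predX_gt0 => //; case/andP: kn.
Qed.

Let int_qfact k : (0 < k <= n)%N -> (qfact p n)%:R / ((p ^ k)%:R - 1) \is a @Num.int R.
Proof.
move=> /andP[k0 kn]; rewrite -natr_pred; apply: int_natr_div; first exact: predX_gt0.
by apply: (@dvdn_prod_nat (fun i => (p ^ i).-1)); rewrite k0 ltnS.
Qed.

Let int_b i : b i \is a Num.int.
Proof. by rewrite rpredN rpredM ?intr_int ?natr_int. Qed.

Let geoE k : (0 < k)%N -> q ^+ k / (1 - q ^+ k) = ((p ^ k)%:R - 1)^-1.
Proof.
move=> k0; have := predX_neq0 k0; have := pX0 k; rewrite qXE.
by move: (p ^ k)%:R => x h1 h2; field; rewrite h1 h2.
Qed.

Let intS k : S`_k \is a Num.int.
Proof. by rewrite /S coef_map /= intr_int. Qed.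

(** Once the zeta value is removed, the only denominators are p^k - 1 with k < 2n from S and p^j - 1
    with j <= n from the truncated tails; D clears them all. *)
Lemma int_form1 : D * form1 - D * (\sum_(i < n.+1) b i) * zetaq1 q \is a Num.int.
Proof.
have -> : D * form1 - D * (\sum_(i < n.+1) b i) * zetaq1 q =
   \sum_(1 <= k < n.*2) S`_k * (D / ((p ^ k)%:R - 1)) -
   \sum_(i < n.+1) b i * \sum_(1 <= j < i.+1) D / ((p ^ j)%:R - 1).
  rewrite /form1.
  have -> : \sum_(1 <= k < n.*2) S`_k * (q ^+ k / (1 - q ^+ k)) =
      \sum_(1 <= k < n.*2) S`_k * ((p ^ k)%:R - 1)^-1.
    by apply: eq_big_nat => k /andP[k0 _]; rewrite geoE.
  have -> : \sum_(1 <= k < n.*2) S`_k * (D / ((p ^ k)%:R - 1)) =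
      D * \sum_(1 <= k < n.*2) S`_k * ((p ^ k)%:R - 1)^-1.
    by rewrite mulr_sumr; apply: eq_bigr => k _; rewrite mulrCA.
  have -> : \sum_(i < n.+1) b i * (\sum_(1 <= j < i.+1) D / ((p ^ j)%:R - 1)) =
      D * (\sum_(i < n.+1) b i) * zetaq1 q -
      D * \sum_(i < n.+1) b i * (zetaq1 q - \sum_(1 <= j < i.+1) q ^+ j / (1 - q ^+ j)).
    rewrite -mulrA mulr_suml !mulr_sumr -sumrB; apply: eq_bigr => i _.
    have -> : \sum_(1 <= j < i.+1) D / ((p ^ j)%:R - 1) =
      D * \sum_(1 <= j < i.+1) q ^+ j / (1 - q ^+ j).
      by rewrite mulr_sumr; apply: eq_big_nat => j /andP[j0 _]; rewrite geoE.
    by ring.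
  by ring.
apply: rpredB.
  by rewrite big_nat rpred_sum // => k kn; rewrite rpredM ?intS ?intD.
apply: rpred_sum => i _; rewrite rpredM // big_nat rpred_sum // => j /andP[j0 ji].
by apply: intD; rewrite j0 /= -addnn; have := ltn_ord i; lia.
Qed.

(* One factor p^j - 1 of the squared denominators is absorbed by D, the other by
   the factor [qfact p n] of the residues. *)
Lemma int_form2 : D * form2 - D * (\sum_(i < n.+1) b i) * zetaq2 q \is a Num.int.
Proof.
have -> : D * form2 - D * (\sum_(i < n.+1) b i) * zetaq2 q =
   \sum_(1 <= k < n.*2) k%:R * S`_k * (D / ((p ^ k)%:R - 1)) -
   \sum_(i < n.+1) \sum_(1 <= j < i.+1) - ((qfact p n)%:R / ((p ^ j)%:R - 1)) * (g i)%:~R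
      * (p ^ j)%:R * (D / ((p ^ j)%:R - 1)).
  rewrite /form2.
  have -> : \sum_(1 <= k < n.*2) k%:R * S`_k * (q ^+ k / (1 - q ^+ k)) =
      \sum_(1 <= k < n.*2) k%:R * S`_k * ((p ^ k)%:R - 1)^-1.
    by apply: eq_big_nat => k /andP[k0 _]; rewrite geoE.
  have -> : \sum_(1 <= k < n.*2) k%:R * S`_k * (D / ((p ^ k)%:R - 1)) =
      D * \sum_(1 <= k < n.*2) k%:R * S`_k * ((p ^ k)%:R - 1)^-1.
    by rewrite mulr_sumr; apply: eq_bigr => k _; rewrite mulrCA.
  have -> : \sum_(i < n.+1) \sum_(1 <= j < i.+1) - ((qfact p n)%:R / ((p ^ j)%:R - 1)) * (g i)%:~R
      * (p ^ j)%:R * (D / ((p ^ j)%:R - 1)) =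
      D * (\sum_(i < n.+1) b i) * zetaq2 q -
      D * \sum_(i < n.+1) b i * (zetaq2 q - \sum_(1 <= j < i.+1) q ^+ j / (1 - q ^+ j) ^+ 2).
    rewrite -mulrA mulr_suml !mulr_sumr -sumrB; apply: eq_bigr => i _.
    have -> : \sum_(1 <= j < i.+1) - ((qfact p n)%:R / ((p ^ j)%:R - 1)) * (g i)%:~R
        * (p ^ j)%:R * (D / ((p ^ j)%:R - 1)) =
        D * b i * \sum_(1 <= j < i.+1) q ^+ j / (1 - q ^+ j) ^+ 2.
      rewrite mulr_sumr; apply: eq_big_nat => j /andP[j0 _].
      have := predX_neq0 j0; have := pX0 j; rewrite qXE /b.
      by move: (p ^ j)%:R (qfact p n)%:R => x y h1 h2; field; rewrite h1 h2.
    by ring.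
  by ring.
apply: rpredB.
  rewrite big_nat rpred_sum // => k kn.
  by apply: rpredM; [rewrite rpredM ?natr_int ?intS | exact: intD].
apply: rpred_sum => i _; rewrite big_nat rpred_sum // => j /andP[j0 ji].
have jn : (j <= n)%N by have := ltn_ord i; lia.
apply: rpredM; last by apply: intD; rewrite j0 -addnn; lia.
rewrite rpredM ?natr_int // rpredM ?intr_int // rpredN int_qfact //.
by rewrite j0.
Qed.

Let approx_ge0 t : (0 < t)%N -> 0 <= approx p n (q ^+ t) :> R.
Proof.
move=> t0; have [tn|nt] := leqP t n; first by rewrite (approx_eq0 R p1 _).1 ?t0.
by have /andP[/ltW] := approx_le R p1 t0 nt.
Qed.

Lemma form1_gt0 : 0 < form1.
Proof.
(* The upper limit is exclusive: the last term kept is t = n + 1, the first one beyond the double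
   zeros. *)
have := sums_to_ge n.+2 approx_ge0 sums_to_approx; apply: lt_le_trans.
rewrite big_nat_recr //= ltr_wpDl //.
  by rewrite big_nat sumr_ge0 // => t /andP[t0 _]; exact: approx_ge0.
by have /andP[] := approx_le R p1 (ltn0Sn n) (ltnSn n).
Qed.

Let termwise t : (0 < t)%N ->
  (n%:R - 4) * approx p n (q ^+ t) <= theta_approx p n (q ^+ t) <= (2 * n + 1)%:R * approx p n (q ^+ t).
Proof.
move=> t0; have [tn|nt] := leqP t n; last exact: theta_approx_bounds.
have t1 : (0 < t <= n)%N by rewrite t0.
have [-> ->] := approx_eq0 R p1 t1.
by rewrite !mulr0 lexx.
Qed.

Lemma form2_bounds : (n%:R - 4) * form1 <= form2 <= (2 * n + 1)%:R * form1.
Proof.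
apply/andP; split.
  refine (ler_sums_to (fun t t0 => _) (sums_toZ (x := _) sums_to_approx) sums_to_theta_approx).
  by case/andP: (termwise t0).
refine (ler_sums_to (fun t t0 => _) sums_to_theta_approx (sums_toZ (x := _) sums_to_approx)).
by case/andP: (termwise t0).
Qed.

Let prodX m k : (\prod_(m <= i < k) p ^ i)%N%:R != 0 :> R.
Proof.
rewrite natr_prod prodf_seq_neq0; apply/allP => i _ /=; exact: pX0.
Qed.

(** D is at most p^(n^2) times the product of the p^k with k < n. Against the bound on [form1] these
    powers cancel, leaving 4 * 2^n q^(2n) = (2q)^n * 4 q^n, and 2q <= 1. *)
Lemma form1_small : D * form1 <= 4 * q ^+ n.
Proof.
set C : R := 2 ^+ n.+1 / \prod_(i < n.+1) (p ^ i)%:R.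
have C0 : 0 <= C by rewrite divr_ge0 ?exprn_ge0 ?prodr_ge0.
have /andP[h1 h2] : 0 < q ^+ n <= 2^-1 := invbaseX_le_half R p1 n0.
(* The terms t <= n vanish; after a shift by n the rest is dominated by a geometric series of ratio
   q^n <= 1/2, whose sum is at most 2 q^n. *)
have F : form1 <= C * (q ^+ n) ^+ n * (2 * q ^+ n).
  have H := sums_to_shift (i := n) sums_to_approx.
  rewrite [X in _ - X]big_nat_cond big1 ?subr0 in H; last first.
    by move=> t /andP[t0 _]; rewrite (approx_eq0 R p1 t0).1.
  have G : 0 <= q ^+ n < 1 by rewrite (ltW h1) (le_lt_trans h2) //; lra.
  have K := sums_toZ (x := C * (q ^+ n) ^+ n) (sums_to_geo G).
  apply: le_trans (ler_sums_to _ H K) _ => [t t0|].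
    have nt : (n < n + t)%N by rewrite -ltn_subLR ?subnn.
    have /andP[_] := approx_le R p1 (leq_trans t0 (leq_addl n t)) nt.
    by move=> h; apply: (le_trans h); rewrite -/C -/q [X in X * C]exprD mulrC mulrA lexx.
  apply: ler_wpM2l; first by rewrite mulr_ge0 // exprn_ge0 // ltW.
  by rewrite ler_pdivrMr; [nra | lra].
have DD : D <= (\prod_(n <= k < n.*2) p ^ k)%N%:R.
  by rewrite ler_nat; apply: leq_prod => k _; exact: leq_pred.
apply: le_trans (ler_pM (ler0n _ _) (ltW form1_gt0) DD F) _.
have -> : (\prod_(n <= k < n.*2) p ^ k)%N%:R = (p ^ n)%:R ^+ n * (\prod_(0 <= k < n) p ^ k)%N%:R :> R.
  rewrite -{1}[n]add0n big_addn -addnn addnK -natrX -natrM; congr (_%:R).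
  rewrite -[X in (_ ^ X * _)%N]subn0 -prod_nat_const_nat -big_split /=.
  by apply: eq_bigr => i _; rewrite expnD mulnC.
have CE : C = 2 ^+ n.+1 * q ^+ n / (\prod_(0 <= k < n) p ^ k)%N%:R.
  rewrite /C -(big_mkord xpredT (fun i => (p ^ i)%:R)) -natr_prod big_nat_recr //= natrM qXE.
  by rewrite invfM mulrA mulrAC.
rewrite CE; have := prodX 0 n; have := pX0 n; rewrite [q ^+ n]qXE in h1 h2 *.
have k2 : 2 ^+ n * (p ^ n)%:R^-1 <= 1 :> R.
  rewrite -qXE -exprMn; apply: exprn_ile1.
    by rewrite mulr_ge0 ?(ltW q0).
  by have := invbase_le_half R p1; rewrite -/q; lra.
move: k2 h1 h2; move: (\prod_(0 <= k < n) p ^ k)%N%:R (p ^ n)%:R => y x k2 h1 h2 x0 y0.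
have -> : x ^+ n * y * (2 ^+ n.+1 * x^-1 / y * x^-1 ^+ n * (2 * x^-1)) =
   (2 ^+ n * x^-1) * (4 * x^-1).
  have xn0 : x ^+ n != 0 by rewrite expf_neq0.
  by rewrite exprVn exprS; field; rewrite xn0 y0 x0.
by rewrite ler_piMl // mulr_ge0 // ltW.
Qed.

End forms.

Lemma linear_forms (R : realType) (p n : nat) : (1 < p)%N -> (0 < n)%N ->
  let q : R := p%:R^-1 in
  exists l1 l2 b : R, [/\ b \is a Num.int,
    l1 - b * zetaq1 q \is a Num.int /\ l2 - b * zetaq2 q \is a Num.int,
    0 < l1 <= 4 * 2^-1 ^+ n &
    (n%:R - 4) * l1 <= l2 <= (2 * n + 1)%:R * l1].
Proof.
move=> p1 n0 q.
have /fin_all_exists[g gP] := fun i => @pf_coef_int R p n i p1.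
set D : R := (\prod_(n <= k < n.*2) (p ^ k).-1)%N%:R.
have D0 : 0 < D.
  rewrite ltr0n big_nat prodn_cond_gt0 // => k /andP[nk _].
  by rewrite predX_gt0 // (leq_trans n0).
exists (D * form1 R p g), (D * form2 R p g),
  (D * \sum_(i < n.+1) - ((qfact p n)%:R * (g i)%:~R)); split.
- by rewrite rpredM ?natr_int // rpred_sum // => i _; rewrite rpredN rpredM ?natr_int ?intr_int.
- by split; [exact: (int_form1 R p1 n0 g) | exact: (int_form2 R p1 n0 g)].
- rewrite mulr_gt0 ?(form1_gt0 p1 n0 gP) //=.
  apply: le_trans (form1_small p1 n0 gP) _; rewrite ler_pM2l //.
  by rewrite lerXn2r ?nnegrE ?invbase_le_half // ?invr_ge0 // ltW // invbase_gt0.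
have /andP[h1 h2] := form2_bounds p1 n0 gP.
by rewrite ![_ * (D * _)]mulrCA !ler_pM2l // h1 h2.
Qed.

(** * From small linear forms to linear independence *)

Lemma lt_expn2 K : exists2 n, (K + 4 < n)%N & (4 * (2 * n + 1) * K < 2 ^ n)%N.
Proof.
(* For n = 3m the left side is 24mK + 4K <= 28Km <= m^2 <= m^3, and cubing m < 2^m gives m^3 <
   2^n. *)
pose m := (28 * K + 6)%N; exists (3 * m)%N; first by rewrite /m; lia.
have h : (m < 2 ^ m)%N by rewrite ltn_expl.
have : (m * m * m < 2 ^ m * 2 ^ m * 2 ^ m)%N by rewrite !ltn_mul.
rewrite -!expnD => h2.
have -> : (3 * m = m + m + m)%N by lia.
by apply: leq_ltn_trans h2; rewrite /m; nia.
Qed.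

(** The relation makes X = e_1 l_1 + e_2 l_2 an integer, and |X| < 1 forces X = 0. If e_2 were
    nonzero, then |e_1| l_1 = |e_2| l_2 >= (n - 4) l_1, against n - 4 > |e_1|. So e_2 = 0, and then
    e_1 = 0 because l_1 > 0. *)
Lemma int_indep (R : realType) (p : nat) (e0 e1 e2 : int) : (1 < p)%N ->
  let q : R := p%:R^-1 in
  e0%:~R + e1%:~R * zetaq1 q + e2%:~R * zetaq2 q = 0 -> [/\ e0 = 0, e1 = 0 & e2 = 0].
Proof.
move=> p1 q E.
(* With K = |e_1| + |e_2|, [nK] gives n - 4 > K, and [nS] gives |X| <= K (2n + 1) l_1 <= 4 K (2n +
   1) / 2^n < 1. *)
have [n nK nS] := lt_expn2 (`|e1| + `|e2|)%N.
have n0 : (0 < n)%N by lia.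
have [l1 [l2 [b [bI [I1 I2] /andP[l10 l1s] /andP[lo hi]]]]] := linear_forms R p1 n0.
rewrite -/q in I1 I2.
set X := e1%:~R * l1 + e2%:~R * l2.
have XI : X \is a Num.int.
  have -> : X = e1%:~R * (l1 - b * zetaq1 q) + e2%:~R * (l2 - b * zetaq2 q) - b * e0%:~R.
    rewrite /X; have -> : e0%:~R = - (e1%:~R * zetaq1 q + e2%:~R * zetaq2 q).
      by move: E => /eqP; rewrite -addrA addr_eq0 => /eqP.
    by ring.
  by rewrite rpredB ?rpredD ?rpredM ?intr_int.
have nR : (`|e1| + `|e2|)%:R + 4 < n%:R :> R by rewrite -natrD ltr_nat.
rewrite natrD in nR.
have e1R : `|e1%:~R| = (`|e1|%N)%:R :> R by rewrite natr_absz intr_norm.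
have e2R : `|e2%:~R| = (`|e2|%N)%:R :> R by rewrite natr_absz intr_norm.
have a0 : 0 <= (`|e1|%N)%:R :> R by [].
have b0 : 0 <= (`|e2|%N)%:R :> R by [].
have l20 : 0 <= l2.
  by apply: le_trans lo; rewrite mulr_ge0 ?(ltW l10) // subr_ge0; lra.
have X1 : `|X| < 1.
  have XB : `|X| <= (`|e1| + `|e2|)%:R * (2 * n + 1)%:R * l1.
    apply: le_trans (ler_normD _ _) _; rewrite !normrM e1R e2R (gtr0_norm l10) (ger0_norm l20).
    rewrite natrD -mulrA mulrDl lerD // ler_wpM2l //.
    by rewrite ler_peMl ?(ltW l10) // ler1n addn1.
  apply: le_lt_trans XB _.
  apply: le_lt_trans (ler_wpM2l _ l1s) _; first by rewrite mulr_ge0.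
  rewrite exprVn mulrA ltr_pdivrMr ?exprn_gt0 // mul1r -!natrM -natrX ltr_nat.
  by apply: leq_ltn_trans nS; rewrite leq_eqVlt; apply/orP; left; apply/eqP; ring.
have X0 : X = 0.
  by apply/eqP; apply: contraTT X1 => X0; rewrite -leNgt norm_intr_ge1.
have e20 : e2 = 0.
  apply/eqP; apply: contraT => e2n.
  have k : 1 <= `|e2%:~R| :> R by rewrite norm_intr_ge1 ?intr_int ?intr_eq0.
  have : `|e2%:~R| * l2 = `|e1%:~R| * l1.
    move: X0; rewrite /X addrC => /eqP; rewrite addr_eq0 => /eqP/(congr1 Num.norm).
    by rewrite normrN !normrM (gtr0_norm l10) (ger0_norm l20).
  rewrite e1R; rewrite e2R in k *; move: nR lo k a0 b0.
  by move: (`|e1|%N)%:R (`|e2|%N)%:R n%:R => x y z; nra.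
have e10 : e1 = 0.
  move: X0; rewrite /X e20 mul0r addr0 => /eqP; rewrite mulf_eq0 (gt_eqF l10) orbF.
  by rewrite intr_eq0 => /eqP.
split=> //; move: E; rewrite e10 e20 !mul0r !addr0 => /eqP.
by rewrite intr_eq0 => /eqP.
Qed.

Theorem theorem1p3 (R : realType) (p : nat) (hp : (2 <= p)%N) :
  let q : R := p%:R^-1 in
  lin_indep_rat [tuple 1; zetaq1 q; zetaq2 q].
Proof.
move=> q c; rewrite !big_ord_recl big_ord0 addr0 /tnth /= mulr1.
set i0 : 'I_3 := ord0; set i1 : 'I_3 := lift i0 ord0; set i2 : 'I_3 := lift i0 (lift ord0 ord0) => E.
(* Multiplying the relation by the product of the three denominators makes its coefficients
   integers, each vanishing exactly when the corresponding [c i] does. *)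
pose N (i : 'I_3) := numq (c i); pose M (i : 'I_3) := denq (c i).
have M0 i : (M i)%:~R != 0 :> R by rewrite intr_eq0 denq_neq0.
have cE i : ratr (c i) = (N i)%:~R / (M i)%:~R :> R by [].
have : (N i0 * M i1 * M i2)%:~R + (N i1 * M i0 * M i2)%:~R * zetaq1 q +
   (N i2 * M i0 * M i1)%:~R * zetaq2 q = 0 :> R.
  rewrite -[RHS](mulr0 ((M i0)%:~R * (M i1)%:~R * (M i2)%:~R)) -E !cE !intrM.
  by field; rewrite !M0.
case/(int_indep hp) => /eqP h0 /eqP h1 /eqP h2.
have MZ i : (M i == 0) = false by apply/negbTE; rewrite denq_neq0.
move: h0 h1 h2; rewrite !mulf_eq0 !MZ !orbF !numq_eq0 => /eqP h0 /eqP h1 /eqP h2 i.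
have : i \in [:: i0; i1; i2] by case: i => [[|[|[|//]]]] Hi.
by rewrite !inE => /or3P[] /eqP ->.
Qed.
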